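(* Let $p\ge 1$ and $s\ge 1$ be integers with $p+s\le N$. For an instance of the Permutation Flowshop Scheduling Problem with $N$ jobs and $M$ machines, the prefix-suffix bound $LB_{p,s}$ can be computed in $O(N^{p+s}M(p+s))$ time.
   Context: An instance of the Permutation Flowshop Scheduling Problem with $N$ jobs and $M$ machines is given by a matrix of non-negative processing times $(t_{i,j})_{1\le i\le M,\,1\le j\le N}$, where $t_{i,j}$ is the processing time of job $j$ on machine $i$. Time is counted in elementary operations, where each arithmetic operation or comparison on processing times has unit cost. An RD-path in a matrix is a path that only moves right or down: from cell $(i,j)$ it may proceed to $(i+1,j)$ or $(i,j+1)$, whenever those cells exist. When start and end positions are not specified, it goes from the top-left to the bottom-right corner. For a permutation $\pi$ of the jobs (columns) and an RD-path $P$ in an $M\times N$ matrix, $s(\pi,P)=\sum_{(i,j)\in P}t_{i,\pi_j}$. For integers $p,s\ge1$ with $p+s\le N$, $\mathcal{U}_{p,s}$ is the set of all RD-paths of the $M\times N$ matrix that, for some row $i$, move from $(1,1)$ to $(i,p)$ via any RD-path, then move right to $(i,N-s+1)$, and finally follow any RD-path to $(M,N)$. The prefix-suffix bound is $$LB_{p,s}=\min_{\pi}\max_{P\in\mathcal{U}_{p,s}}s(\pi,P),$$ where the minimum is over all permutations $\pi$ of the $N$ jobs. *)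

(* Defs.v *)
From mathcomp Require Import all_boot all_order all_algebra all_fingroup.

Set Implicit Arguments.
Unset Strict Implicit.
Unset Printing Implicit Defensive.

Import Order.TTheory GRing.Theory Num.Theory.

(** * RD-paths and the prefix-suffix bound *)

Section Paths.
Variables M N : nat.

Definition cell : Type := ('I_M * 'I_N)%type.

(* Ordinals count from 0; rows and columns of the matrix are numbered from 1. *)
Definition pos (c : cell) : nat * nat := (c.1.+1, c.2.+1).

Definition right_step : rel cell :=
  fun c d => pos d == ((pos c).1, (pos c).2.+1).

Definition down_step : rel cell :=
  fun c d => pos d == ((pos c).1.+1, (pos c).2).

Definition rd_step : rel cell := fun c d => right_step c d || down_step c d.

(* The cells visited are [a :: q]; [q] lists those after the start [a]. *)
Definition rd_path (a : cell) (q : seq cell) (b : cell) : Prop :=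
  path rd_step a q /\ last a q = b.

Definition right_path (a : cell) (q : seq cell) (b : cell) : Prop :=
  path right_step a q /\ last a q = b.

Definition prefix_suffix_path (p s : nat) (P : seq cell) : Prop :=
  exists (i : nat) (a b c d : cell) (q1 q2 q3 : seq cell),
    [/\ pos a = (1, 1), pos b = (i, p), pos c = (i, N - s + 1)
      & pos d = (M, N)] /\
    [/\ rd_path a q1 b, right_path b q2 c, rd_path c q3 d
      & P = a :: q1 ++ q2 ++ q3].

End Paths.

Section Bound.
Local Open Scope ring_scope.
Variables (R : realFieldType) (M N : nat) (t : 'M[R]_(M, N)).

Definition path_sum (pi : 'S_N) (P : seq (cell M N)) : R :=
  \sum_(c <- P) t c.1 (pi c.2).

Definition is_max (S : R -> Prop) (v : R) : Prop :=
  S v /\ forall x, S x -> x <= v.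

Definition is_min (S : R -> Prop) (v : R) : Prop :=
  S v /\ forall x, S x -> v <= x.

(* [v] is the minimum over [pi] of the maximum over the prefix-suffix paths [P]
   of [path_sum pi P]. *)
Definition is_LB (p s : nat) (v : R) : Prop :=
  is_min (fun w => exists pi : 'S_N,
    is_max (fun x => exists2 P, prefix_suffix_path p s P & x = path_sum pi P) w)
  v.

End Bound.

(** * Unit-cost real RAM

  Programs of a small structured language over two disjoint sorts: natural
  numbers, used for indexing and control, and numbers of [R], which hold
  processing times. There is no conversion between the sorts, except that
  literals are available in both; in particular numbers of [R] cannot be
  rounded or used as addresses. Every operator, comparison, variable access,
  array access, literal and assignment has cost 1, on both sorts. *)

(* Each sort has scalar variables and arrays, both named by natural numbers. *)
Inductive iexp : Type :=
| IConst of nat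
| IVar of nat
| IArr of nat & iexp
| IAdd of iexp & iexp
| ISub of iexp & iexp.

Inductive arith : Type := Add | Sub | Mul | Div.

(* [RInput e1 e2] reads an entry of the instance matrix, indexed from 0. *)
Inductive rexp : Type :=
| RConst of nat
| RVar of nat
| RArr of nat & iexp
| RInput of iexp & iexp
| ROp of arith & rexp & rexp.

Inductive test : Type :=
| ILe of iexp & iexp
| RLe of rexp & rexp.

Inductive com : Type :=
| Skip
| ISet of nat & iexp
| IArrSet of nat & iexp & iexp
| RSet of nat & rexp
| RArrSet of nat & iexp & rexp
| Seq of com & com
| If of test & com & com
| While of test & com.

Fixpoint icost (e : iexp) : nat :=
  match e with
  | IConst _ | IVar _ => 1
  | IArr _ e1 => 1 + icost e1
  | IAdd e1 e2 | ISub e1 e2 => 1 + icost e1 + icost e2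
  end.

Fixpoint rcost (e : rexp) : nat :=
  match e with
  | RConst _ | RVar _ => 1
  | RArr _ e1 => 1 + icost e1
  | RInput e1 e2 => 1 + icost e1 + icost e2
  | ROp _ e1 e2 => 1 + rcost e1 + rcost e2
  end.

Definition tcost (b : test) : nat :=
  match b with
  | ILe e1 e2 => 1 + icost e1 + icost e2
  | RLe e1 e2 => 1 + rcost e1 + rcost e2
  end.

Definition upd (T : Type) (f : nat -> T) (x : nat) (v : T) : nat -> T :=
  fun y => if y == x then v else f y.

Section Semantics.
Local Open Scope ring_scope.
Variables (R : realFieldType) (M N : nat) (t : 'M[R]_(M, N)).

Record state : Type := State {
  ivar : nat -> nat;
  iarr : nat -> nat -> nat;
  rvar : nat -> R;
  rarr : nat -> nat -> R
}.

Definition entry (i j : nat) : R :=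
  match insub i, insub j with
  | Some i', Some j' => t i' j'
  | _, _ => 0
  end.

Fixpoint ieval (st : state) (e : iexp) : nat :=
  match e with
  | IConst n => n
  | IVar x => ivar st x
  | IArr a e1 => iarr st a (ieval st e1)
  | IAdd e1 e2 => (ieval st e1 + ieval st e2)%N
  | ISub e1 e2 => (ieval st e1 - ieval st e2)%N
  end.

Definition arith_eval (o : arith) (x y : R) : R :=
  match o with
  | Add => x + y
  | Sub => x - y
  | Mul => x * y
  | Div => x / y
  end.

Fixpoint reval (st : state) (e : rexp) : R :=
  match e with
  | RConst n => n%:R
  | RVar x => rvar st x
  | RArr a e1 => rarr st a (ieval st e1)
  | RInput e1 e2 => entry (ieval st e1) (ieval st e2)
  | ROp o e1 e2 => arith_eval o (reval st e1) (reval st e2)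
  end.

Definition teval (st : state) (b : test) : bool :=
  match b with
  | ILe e1 e2 => (ieval st e1 <= ieval st e2)%N
  | RLe e1 e2 => reval st e1 <= reval st e2
  end.

Definition set_ivar st x v :=
  State (upd (ivar st) x v) (iarr st) (rvar st) (rarr st).
Definition set_iarr st a k v :=
  State (ivar st) (upd (iarr st) a (upd (iarr st a) k v)) (rvar st) (rarr st).
Definition set_rvar st x v :=
  State (ivar st) (iarr st) (upd (rvar st) x v) (rarr st).
Definition set_rarr st a k v :=
  State (ivar st) (iarr st) (rvar st) (upd (rarr st) a (upd (rarr st a) k v)).

Local Open Scope nat_scope.

(* [exec c st st' n]: [c] started in [st] halts in [st'] at total cost [n]. *)
Inductive exec : com -> state -> state -> nat -> Prop :=
| ExecSkip st :
    exec Skip st st 1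
| ExecISet st x e :
    exec (ISet x e) st (set_ivar st x (ieval st e)) (1 + icost e)
| ExecIArrSet st a k e :
    exec (IArrSet a k e) st (set_iarr st a (ieval st k) (ieval st e))
      (1 + icost k + icost e)
| ExecRSet st x e :
    exec (RSet x e) st (set_rvar st x (reval st e)) (1 + rcost e)
| ExecRArrSet st a k e :
    exec (RArrSet a k e) st (set_rarr st a (ieval st k) (reval st e))
      (1 + icost k + rcost e)
| ExecSeq st1 st2 st3 c1 c2 n1 n2 :
    exec c1 st1 st2 n1 -> exec c2 st2 st3 n2 ->
    exec (Seq c1 c2) st1 st3 (n1 + n2)
| ExecIfTrue st st' b c1 c2 n :
    teval st b = true -> exec c1 st st' n ->
    exec (If b c1 c2) st st' (1 + tcost b + n)
| ExecIfFalse st st' b c1 c2 n :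
    teval st b = false -> exec c2 st st' n ->
    exec (If b c1 c2) st st' (1 + tcost b + n)
| ExecWhileFalse st b c :
    teval st b = false ->
    exec (While b c) st st (1 + tcost b)
| ExecWhileTrue st1 st2 st3 b c n1 n2 :
    teval st1 b = true -> exec c st1 st2 n1 -> exec (While b c) st2 st3 n2 ->
    exec (While b c) st1 st3 (1 + tcost b + n1 + n2).

Definition init_state (p s : nat) : state :=
  State (nth 0 [:: N; M; p; s]) (fun _ _ => 0)
        (fun _ => 0%R) (fun _ _ => 0%R).

(* The result is left in the real variable 0. *)
Definition computes_in (alg : com) (p s : nat) (v : R) (T : nat) : Prop :=
  exists2 st, exec alg (init_state p s) st T & rvar st 0 = v.

End Semantics.

(* Main.v *)
Require Import Defs.
From mathcomp Require Import all_boot all_order all_algebra all_fingroup.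
From mathcomp Require Import zify ring lra.

Set Implicit Arguments.
Unset Strict Implicit.
Unset Printing Implicit Defensive.

Import Order.TTheory GRing.Theory Num.Theory.

(** Fix a permutation. A prefix-suffix path moves freely in the first p and the
    last s columns and crosses the columns in between along a single row i,
    where it collects the total of row i minus the entries of row i that belong
    to the p + s jobs at the two ends. So the longest such path depends only on
    the ordered choice x of these p + s jobs, and the order of the other jobs is
    irrelevant ([bound_value_is_max]). The bound is therefore a minimum over the
    at most N ^ (p + s) injective tuples x, each of which is realised by a
    permutation ([perm_of_ends]).

    Once the M row totals are known, the value of one tuple takes
    O(M (p + s)) operations: one array indexed by the rows is swept through the
    p prefix columns by the longest-path recurrence, corrected by row total
    minus used entries, and swept through the s suffix columns. Non-negativity
    lets the sweep start from an array of zeros: a path that starts in the first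
    column below the top row loses nothing by being extended up to the corner.

    The program counts through all tuples as base-N numerals of length p + s.
    A tuple is injective exactly when, after writing each position k into a
    table at the address x k, every position reads itself back; this costs
    O(p + s), as does the increment of the numeral with its carries. Computing
    the row totals costs O(M N), which is absorbed since N <= N ^ (p + s).

    Programs are verified with a weakest precondition that also bounds the cost
    ([wp]). What a command leaves unchanged follows from its syntax ([agree],
    [exec_agree]), so that specifications mention only what changes. *)

(** * Total correctness with a bound on the cost *)

Section Frame.

Fixpoint writes (target : com -> seq nat) (c : com) : seq nat :=
  match c with
  | Seq c1 c2 | If _ c1 c2 => writes target c1 ++ writes target c2
  | While _ c1 => writes target c1
  | _ => target c
  end.

Definition ivar_writes :=
  writes (fun c => if c is ISet x _ then [:: x] else [::]).
Definition iarr_writes :=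
  writes (fun c => if c is IArrSet a _ _ then [:: a] else [::]).
Definition rvar_writes :=
  writes (fun c => if c is RSet x _ then [:: x] else [::]).
Definition rarr_writes :=
  writes (fun c => if c is RArrSet a _ _ then [:: a] else [::]).

Variable R : realFieldType.

(** Arrays are compared as whole functions: one that [c] assigns to anywhere is
    left unconstrained at all its addresses. *)
Definition agree (c : com) (st st' : state R) : Prop :=
  [/\ forall x, x \notin ivar_writes c -> ivar st' x = ivar st x,
      forall a, a \notin iarr_writes c -> iarr st' a = iarr st a,
      forall x, x \notin rvar_writes c -> rvar st' x = rvar st x
    & forall a, a \notin rarr_writes c -> rarr st' a = rarr st a].

Lemma agree_refl c st : agree c st st.
Proof. by []. Qed.

Lemma agree_trans c st1 st2 st3 :
  agree c st1 st2 -> agree c st2 st3 -> agree c st1 st3.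
Proof.
move=> [a1 a2 a3 a4] [b1 b2 b3 b4].
by split=> x hx; [rewrite b1 ?a1|rewrite b2 ?a2|rewrite b3 ?a3|rewrite b4 ?a4].
Qed.

Lemma agree_sub c c' st st' :
  {subset ivar_writes c <= ivar_writes c'} ->
  {subset iarr_writes c <= iarr_writes c'} ->
  {subset rvar_writes c <= rvar_writes c'} ->
  {subset rarr_writes c <= rarr_writes c'} ->
  agree c st st' -> agree c' st st'.
Proof.
move=> s1 s2 s3 s4 [a1 a2 a3 a4].
by split=> x hx; [apply: a1|apply: a2|apply: a3|apply: a4];
   apply: contra hx; [apply: s1|apply: s2|apply: s3|apply: s4].
Qed.

Lemma exec_agree M N (t : 'M[R]_(M, N)) c st st' n :
  exec t c st st' n -> agree c st st'.
Proof.
elim=> {c st st' n}.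
- exact: agree_refl.
- by move=> st x e; split=> //= y; rewrite inE /upd => /negbTE->.
- by move=> st x k e; split=> //= y; rewrite inE /upd => /negbTE->.
- by move=> st x e; split=> //= y; rewrite inE /upd => /negbTE->.
- by move=> st x k e; split=> //= y; rewrite inE /upd => /negbTE->.
- move=> st1 st2 st3 c1 c2 _ _ _ a1 _ a2.
  apply: (@agree_trans _ _ st2); [apply: agree_sub a1|apply: agree_sub a2];
    by move=> x; rewrite mem_cat => ->; rewrite ?orbT.
- move=> st st' b c1 c2 _ _ _; apply: agree_sub;
    by move=> x; rewrite mem_cat => ->; rewrite ?orbT.
- move=> st st' b c1 c2 _ _ _; apply: agree_sub;
    by move=> x; rewrite mem_cat => ->; rewrite ?orbT.
- by move=> *; exact: agree_refl.
- by move=> st1 st2 st3 b c _ _ _ _ a1 _; apply: agree_trans.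
Qed.

End Frame.

(** The test compares x + 1 with the bound because the language has no strict
    comparison. *)
Definition Upto (x y : nat) (body : com) : com :=
  While (ILe (IAdd (IVar x) (IConst 1)) (IVar y))
        (Seq body (ISet x (IAdd (IVar x) (IConst 1)))).

Definition For (x y : nat) (body : com) : com :=
  Seq (ISet x (IConst 0)) (Upto x y body).

Section Wp.
Variables (R : realFieldType) (M N : nat) (t : 'M[R]_(M, N)).
Implicit Types (st : state R) (Q : state R -> Prop).

Definition wp (c : com) (T : nat) Q st : Prop :=
  exists st' n, [/\ exec t c st st' n, n <= T & Q st'].

Lemma wp_weaken c T T' Q st : wp c T Q st -> T <= T' -> wp c T' Q st.
Proof.
move=> [st' [n [e le q]]] TT'; exists st', n; split=> //.
exact: leq_trans TT'.
Qed.

Lemma wp_conseq c T (P Q : state R -> Prop) st :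
  wp c T P st -> (forall st', agree c st st' -> P st' -> Q st') -> wp c T Q st.
Proof.
move=> [st' [n [e le q]]] PQ; exists st', n; split=> //.
exact: PQ (exec_agree e) q.
Qed.

Lemma wp_skip Q st : Q st -> wp Skip 1 Q st.
Proof. by exists st, 1; split=> //; constructor. Qed.

Lemma wp_iset x e Q st :
  Q (set_ivar st x (ieval st e)) -> wp (ISet x e) (1 + icost e) Q st.
Proof. by move=> q; eexists; eexists; split; [constructor| |]. Qed.

Lemma wp_iarrset a k e Q st :
  Q (set_iarr st a (ieval st k) (ieval st e)) ->
  wp (IArrSet a k e) (1 + icost k + icost e) Q st.
Proof. by move=> q; eexists; eexists; split; [constructor| |]. Qed.

Lemma wp_rset x e Q st :
  Q (set_rvar st x (reval t st e)) -> wp (RSet x e) (1 + rcost e) Q st.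
Proof. by move=> q; eexists; eexists; split; [constructor| |]. Qed.

Lemma wp_rarrset a k e Q st :
  Q (set_rarr st a (ieval st k) (reval t st e)) ->
  wp (RArrSet a k e) (1 + icost k + rcost e) Q st.
Proof. by move=> q; eexists; eexists; split; [constructor| |]. Qed.

Lemma wp_seq c1 c2 T1 T2 Q st :
  wp c1 T1 (wp c2 T2 Q) st -> wp (Seq c1 c2) (T1 + T2) Q st.
Proof.
move=> [st1 [n1 [e1 l1 [st2 [n2 [e2 l2 q]]]]]].
exists st2, (n1 + n2); split=> //; last exact: leq_add.
exact: ExecSeq e1 e2.
Qed.

Lemma wp_seq_agree c1 c2 T1 T2 (P Q : state R -> Prop) st :
  wp c1 T1 P st ->
  (forall st', agree c1 st st' -> P st' -> wp c2 T2 Q st') ->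
  wp (Seq c1 c2) (T1 + T2) Q st.
Proof. by move=> w1 w2; apply: wp_seq; apply: wp_conseq w1 w2. Qed.

Lemma wp_if b c1 c2 T1 T2 Q st :
  (teval t st b -> wp c1 T1 Q st) -> (~~ teval t st b -> wp c2 T2 Q st) ->
  wp (If b c1 c2) (1 + tcost b + maxn T1 T2) Q st.
Proof.
case: (boolP (teval t st b)) => hb w1 w2.
  have [st' [n [e le q]]] := w1 isT.
  exists st', (1 + tcost b + n); split=> //; last by lia.
  exact: ExecIfTrue.
have [st' [n [e le q]]] := w2 isT.
exists st', (1 + tcost b + n); split=> //; last by lia.
by apply: ExecIfFalse => //; apply/negbTE.
Qed.

(** The invariant is indexed by a counter which need not be stored in the
    state: the test only has to tell whether the counter has reached [n]. *)
Lemma wp_while b c (I : nat -> state R -> Prop) n T r st :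
  r <= n -> I r st ->
  (forall m st', I m st' -> teval t st' b = (m < n)) ->
  (forall m st', r <= m < n -> agree c st st' -> I m st' ->
     wp c T (I m.+1) st') ->
  wp (While b c) ((n - r) * (1 + tcost b + T) + (1 + tcost b)) (I n) st.
Proof.
move=> rn Ir tb body.
suff main m st' : r <= m <= n -> agree c st st' -> I m st' ->
    wp (While b c) ((n - m) * (1 + tcost b + T) + (1 + tcost b)) (I n) st'.
  by apply: main => //; rewrite leqnn.
elim: {m}(n - m) {-2}m (erefl (n - m)) st' => [|d IH] m dE st' rmn ag Im.
  have mn : m = n by lia.
  exists st', (1 + tcost b); split; [|lia|by rewrite -mn].
  by apply: ExecWhileFalse; rewrite (tb _ _ Im) mn ltnn.
have mn : m < n by lia.
have rm : r <= m < n by lia.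
have [st1 [n1 [e1 l1 I1]]] := body _ _ rm ag Im.
have dE1 : n - m.+1 = d by lia.
have rm1 : r <= m.+1 <= n by lia.
have [st2 [n2 [e2 l2 I2]]] :=
  IH _ dE1 _ rm1 (agree_trans ag (exec_agree e1)) I1.
exists st2, (1 + tcost b + n1 + n2); split=> //.
  by apply: ExecWhileTrue e1 e2; rewrite (tb _ _ Im).
by have -> : n - m = (n - m.+1).+1 by [lia]; rewrite mulSn; lia.
Qed.

(** The invariant is required after [x] has been incremented, in the state
    [set_ivar st'' x k.+1], which spares every loop body a separate treatment of
    its counter. The test costs 5, its evaluation 1 and the increment 4. *)
Lemma wp_upto x y body (I : nat -> state R -> Prop) a n T st :
  x \notin ivar_writes body -> y \notin x :: ivar_writes body ->
  ivar st x = a -> ivar st y = n -> a <= n -> I a st ->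
  (forall k st', a <= k < n -> ivar st' x = k -> agree (Upto x y body) st st' ->
     I k st' -> wp body T (fun st'' => I k.+1 (set_ivar st'' x k.+1)) st') ->
  wp (Upto x y body) ((n - a) * (T + 10) + 6)
     (fun st' => I n st' /\ ivar st' x = n) st.
Proof.
rewrite inE negb_or => xb /andP[yx yb] stx sty an Ia step.
pose J k st' := [/\ I k st', ivar st' x = k & ivar st' y = n].
apply: (@wp_conseq _ _ (J n)); last by move=> st' _ [].
apply: (@wp_weaken _ ((n - a) * (1 + 5 + (T + 4)) + (1 + 5))); last first.
  by rewrite leq_add2r leq_mul2l; apply/orP; right; lia.
apply: (wp_while (I := J)) => //.
- by move=> m st' [_ ex ey]; rewrite /= ex ey addn1.
move=> m st' amn ag [Im ex ey].
apply: wp_seq_agree (step _ _ amn ex ag Im) _ => st'' ag' I'.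
apply: wp_iset => /=.
have ex' : ivar st'' x = m by case: ag' => -> //.
have ey' : ivar st'' y = n by case: ag' => -> //.
by split; rewrite /= /upd ?eqxx ?ex' ?addn1 // (negbTE yx).
Qed.

Lemma wp_for x y body (I : nat -> state R -> Prop) n T st :
  x \notin ivar_writes body -> y \notin x :: ivar_writes body ->
  ivar st y = n -> I 0 (set_ivar st x 0) ->
  (forall k st', k < n -> ivar st' x = k -> agree (For x y body) st st' ->
     I k st' -> wp body T (fun st'' => I k.+1 (set_ivar st'' x k.+1)) st') ->
  wp (For x y body) (n * (T + 10) + 8) (fun st' => I n st') st.
Proof.
move=> xb yb sty I0 step.
apply: (@wp_weaken _ (2 + ((n - 0) * (T + 10) + 6))); last by lia.
apply: wp_seq; apply: wp_iset => /=.
apply: (@wp_conseq _ _ (fun st' => I n st' /\ ivar st' x = n)); last first.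
  by move=> st' _ [].
apply: (@wp_upto _ _ _ I) => //=.
- by rewrite /upd eqxx.
- by move: yb; rewrite inE negb_or /upd => /andP[/negbTE-> _].
move=> k st' kn kx ag Ik; apply: step => //.
apply: agree_trans (agree_sub _ _ _ _ ag) => //; last first.
  by move=> z /=; rewrite /ivar_writes /= inE => ->; rewrite orbT.
by split=> // z; rewrite /ivar_writes /= inE negb_or /upd => /andP[/negbTE->].
Qed.

End Wp.

(** * Longest monotone paths *)

Section Dp.
Local Open Scope ring_scope.
Variable R : realFieldType.

(** The longest-path recurrence within one column of weights [u], where [g i] is
    the best value with which row [i] can be entered from the left. *)
Fixpoint column_dp (g u : nat -> R) (i : nat) : R :=
  match i with
  | 0%N => g 0%N + u 0%N
  | i'.+1 => Num.max (g i) (column_dp g u i') + u i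
  end.

Fixpoint columns_dp (u : nat -> nat -> R) (g : nat -> R) (n : nat) : nat -> R :=
  match n with
  | 0%N => g
  | n'.+1 => column_dp (columns_dp u g n') (u n')
  end.

Lemma column_dp_right g u i : g i + u i <= column_dp g u i.
Proof. by case: i => [|i] //=; rewrite lerD2r le_max lexx. Qed.

Lemma column_dp_down g u i : column_dp g u i + u i.+1 <= column_dp g u i.+1.
Proof. by rewrite /= lerD2r le_max lexx orbT. Qed.

Lemma eq_column_dp m g g' u u' :
  (forall i, (i < m)%N -> g i = g' i) -> (forall i, (i < m)%N -> u i = u' i) ->
  forall i, (i < m)%N -> column_dp g u i = column_dp g' u' i.
Proof.
move=> gg uu; elim=> [|i IH] im /=; first by rewrite gg ?uu.
by rewrite gg // uu // IH //; apply: ltnW.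
Qed.

Lemma eq_columns_dp m n (u u' : nat -> nat -> R) g g' :
  (forall i, (i < m)%N -> g i = g' i) ->
  (forall k i, (k < n)%N -> (i < m)%N -> u k i = u' k i) ->
  forall i, (i < m)%N -> columns_dp u g n i = columns_dp u' g' n i.
Proof.
move=> gg; elim: n => [|n IH] uu //= i im.
apply: (@eq_column_dp m) => // j jm; last exact: uu.
by apply: IH => // k l kn; apply: uu; apply: ltnW.
Qed.

End Dp.

Section RDPaths.
Local Open Scope ring_scope.
Variables (R : realFieldType) (M N : nat) (w : nat -> nat -> R).
Implicit Types (a b c d : cell M N) (q : seq (cell M N)).

Lemma right_stepP c d :
  reflect (d.1 = c.1 :> nat /\ d.2 = c.2.+1 :> nat) (right_step c d).
Proof.
by apply: (iffP eqP) => [[-> ->]//|[e1 e2]]; rewrite /pos /= e1 e2.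
Qed.

Lemma down_stepP c d :
  reflect (d.1 = c.1.+1 :> nat /\ d.2 = c.2 :> nat) (down_step c d).
Proof.
by apply: (iffP eqP) => [[-> ->]//|[e1 e2]]; rewrite /pos /= e1 e2.
Qed.

Lemma rd_path_cat a q b r c :
  rd_path a q b -> rd_path b r c -> rd_path a (q ++ r) c.
Proof. by move=> [pq <-] [pr <-]; split; rewrite ?cat_path ?pq ?last_cat. Qed.

Lemma exists_down_path a b :
  a.2 = b.2 -> (a.1 <= b.1)%N -> exists q, rd_path a q b.
Proof.
move: b => [b1 b2] /= ab2; move: a ab2 => [a1 a2] /= ->.
elim: {a1 a2}(b1 - a1)%N {-2}a1 (erefl (b1 - a1)%N) => [|n IH] a1 nE le.
  by exists [::]; split=> //=; congr pair; apply: val_inj => /=; lia.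
have lt : (a1.+1 < M)%N by have := ltn_ord b1; lia.
have [|/=|q [pq lq]] := IH (Ordinal lt); [by rewrite /=; lia|lia|].
exists ((Ordinal lt, b2) :: q); split=> //=; rewrite pq andbT.
by apply/orP; right; apply/down_stepP.
Qed.

Lemma exists_right_path a b :
  a.1 = b.1 -> (a.2 <= b.2)%N -> exists q, right_path a q b.
Proof.
move: b => [b1 b2] /= ab; move: a ab => [a1 a2] /= ->.
elim: {a1 a2}(b2 - a2)%N {-2}a2 (erefl (b2 - a2)%N) => [|n IH] a2 nE le.
  by exists [::]; split=> //=; congr pair; apply: val_inj => /=; lia.
have lt : (a2.+1 < N)%N by have := ltn_ord b2; lia.
have [|/=|q [pq lq]] := IH (Ordinal lt); [by rewrite /=; lia|lia|].
exists ((b1, Ordinal lt) :: q); split=> //=; rewrite pq andbT.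
by apply/right_stepP.
Qed.

Lemma right_path_sum a q b :
  right_path a q b ->
  [/\ b.1 = a.1, (a.2 <= b.2)%N &
  \sum_(c <- q) w c.2 c.1 = \sum_(a.2.+1 <= k < b.2.+1) w k a.1].
Proof.
move=> [pq <-]; elim: q a pq => [|c q IH] a /=.
  by rewrite big_nil big_geq.
case/andP=> /right_stepP[e1 e2] /IH[h1 h2 h3].
split; [by apply: val_inj; rewrite h1|by lia|].
rewrite big_cons h3 e1 e2 [RHS]big_ltn //; lia.
Qed.

(** The values of the recurrence form a potential which grows along each step by
    at least the weight of the cell that is reached. *)
Lemma rd_path_sum_le off g a q :
  path (@rd_step M N) a q -> (off <= a.2)%N ->
  let v b := columns_dp (fun k => w (off + k)) g (b.2 - off).+1 b.1 in
  v a + \sum_(c <- q) w c.2 c.1 <= v (last a q).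
Proof.
move=> pq; elim: q a pq => [|c q IH] a /=; first by rewrite big_nil addr0.
case/andP=> ac pq oa.
have oc : (off <= c.2)%N.
  by case/orP: ac => [/right_stepP|/down_stepP] [_ e]; lia.
apply: le_trans (IH c pq oc); rewrite big_cons addrA lerD2r {IH pq}.
case/orP: ac => [/right_stepP|/down_stepP] [e1 e2].
  have -> : (c.2 - off = (a.2 - off).+1)%N by lia.
  rewrite e1; apply: le_trans (column_dp_right _ _ _); rewrite lerD2l.
  by have -> : (off + (a.2 - off).+1 = c.2)%N by lia.
rewrite e1 e2; apply: le_trans (column_dp_down _ _ _); rewrite lerD2l.
by have -> : (off + (a.2 - off) = a.2)%N by lia.
Qed.

(** The path may start in any row of column [off]: the entering values [g]
    decide which row is best. Together with [rd_path_sum_le] this makes the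
    recurrence the exact maximum. *)
Lemma rd_path_attains off g k b :
  b.2 = (off + k)%N :> nat ->
  exists a q, [/\ rd_path a q b, a.2 = off :> nat &
    columns_dp (fun k => w (off + k)) g k.+1 b.1 <=
    g a.1 + \sum_(c <- a :: q) w c.2 c.1].
Proof.
pose reach b (v : R) := exists a q, [/\ rd_path a q b, a.2 = off :> nat &
  v <= g a.1 + \sum_(c <- a :: q) w c.2 c.1].
have step c d v : reach c v -> rd_step c d -> reach d (v + w d.2 d.1).
  move=> [a [q [[pq lq] a2 le]]] cd; exists a, (rcons q d); split=> //.
    by split; rewrite ?last_rcons // rcons_path pq lq.
  by rewrite -rcons_cons big_rcons /= addrA lerD2r.
have column j (h : nat -> R) :
    (forall b, b.2 = j :> nat -> reach b (h b.1 + w j b.1)) ->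
    forall b, b.2 = j :> nat -> reach b (column_dp h (w j) b.1).
  move=> enter [i l] /= lj.
  have [n iE] : exists n, n = i :> nat by exists i.
  elim: n i iE => [|n IH] i iE; rewrite -iE /=.
    by rewrite iE; apply: enter.
  case: leP => _; last by rewrite iE; apply: enter.
  have nM : (n < M)%N by have := ltn_ord i; lia.
  rewrite iE -[in w j i]lj; apply: (step (Ordinal nM, l)); first exact: IH.
  by apply/orP; right; apply/down_stepP.
elim: k b => [|k IH] b; apply: column => {}b bk.
  exists b, [::]; split; [by []|by rewrite bk addn0|].
  by rewrite big_seq1 bk.
have lt : (off + k < N)%N by have := ltn_ord b.2; lia.
rewrite -bk; apply: (step (b.1, Ordinal lt)); first exact: IH.
by apply/orP; left; apply/right_stepP; rewrite /= bk addnS.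
Qed.

End RDPaths.

(** * The value of an ordered choice of first and last jobs *)

Definition perm_job N (pi : 'S_N) (k : nat) : nat :=
  if insub k is Some j then val (pi j) else 0.

Section BoundValue.
Local Open Scope ring_scope.
Variables (R : realFieldType) (M N : nat) (t : 'M[R]_(M, N)) (p s : nat).

(** A tuple of end jobs is a function [x] on [nat] of which only the first p + s
    values count: x 0, ..., x (p - 1) are the first jobs and x p, ...,
    x (p + s - 1) the last ones. *)
Definition used_time (x : nat -> nat) (i : nat) : R :=
  \sum_(0 <= k < p + s) entry t i (x k).

Definition row_sum (i : nat) : R := \sum_(0 <= j < N) entry t i j.

Definition tuple_times (x : nat -> nat) (k i : nat) : R := entry t i (x k).

Definition prefix_value (x : nat -> nat) : nat -> R :=
  columns_dp (tuple_times x) (fun _ => 0) p.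

Definition middle_value (x : nat -> nat) (i : nat) : R :=
  prefix_value x i + row_sum i - used_time x i.

Definition bound_value (x : nat -> nat) : R :=
  columns_dp (fun k => tuple_times x (p + k)) (middle_value x) s M.-1.

Lemma perm_jobE (pi : 'S_N) (j : 'I_N) : perm_job pi j = pi j.
Proof. by rewrite /perm_job valK. Qed.

Lemma entryE (i : 'I_M) (j : 'I_N) : entry t i j = t i j.
Proof. by rewrite /entry !valK. Qed.

Lemma path_sumE (pi : 'S_N) P :
  path_sum t pi P = \sum_(c <- P) tuple_times (perm_job pi) c.2 c.1.
Proof. by apply: eq_bigr => c _; rewrite /tuple_times perm_jobE entryE. Qed.

Lemma row_sum_perm (pi : 'S_N) i :
  row_sum i = \sum_(0 <= k < N) tuple_times (perm_job pi) k i.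
Proof.
rewrite /row_sum !big_mkord (reindex_inj (perm_inj (s := pi))) /=.
by apply: eq_bigr => j _; rewrite /tuple_times perm_jobE.
Qed.

(** The upper bound adds the potentials of the two free regions and the middle
    stretch of the path. The converse glues the optimal paths of the two
    regions; the prefix recurrence, started from zeros, may return a path that
    begins below the top row, and prolonging it to the corner does not decrease
    its sum since processing times are non-negative. *)
Lemma bound_value_is_max (pi : 'S_N) (x : nat -> nat) :
  (0 < M)%N -> (0 < p)%N -> (0 < s)%N -> (p + s <= N)%N ->
  (forall i j, 0 <= t i j) ->
  (forall k, (k < p)%N -> x k = perm_job pi k) ->
  (forall k, (k < s)%N -> x (p + k)%N = perm_job pi (N - s + k)) ->
  is_max (fun v => exists2 P, prefix_suffix_path p s P & v = path_sum t pi P)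
    (bound_value x).
Proof.
move=> M0 p0 s0 psN t0 xp xs.
pose w := tuple_times (perm_job pi).
have w0 k i : 0 <= w k i.
  by rewrite /w /tuple_times /entry; case: insub => // i'; case: insub.
have pre i : prefix_value x i = columns_dp w (fun=> 0) p i.
  apply: (@eq_columns_dp _ i.+1) => // k j kp _.
  by rewrite /w /tuple_times xp.
(* All jobs outside the two ends lie in the columns p, ..., N - s - 1 (counted
   from 0), so the subtraction leaves the middle stretch of the permuted row. *)
pose g i := prefix_value x i + \sum_(p <= k < N - s) w k i.
have gE i : middle_value x i = g i.
  rewrite /middle_value /g -addrA; congr (_ + _).
  rewrite (row_sum_perm pi) /used_time.
  rewrite (big_cat_nat (n := p)) //=; last by lia.
  rewrite (big_cat_nat (n := (N - s)%N) (m := p)) //=; [|lia|lia].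
  rewrite [\sum_(0 <= k < p + s) _](big_cat_nat (n := p)) //=; last by lia.
  have -> : \sum_(0 <= k < p) entry t i (x k) = \sum_(0 <= k < p) w k i.
    by apply: eq_big_nat => k /andP[_ kp]; rewrite /w /tuple_times xp.
  have -> : \sum_(p <= k < p + s) entry t i (x k)
      = \sum_(N - s <= k < N) w k i.
    rewrite -{1}(add0n p) (addnC p s) big_addn addnK.
    rewrite -{1}(add0n (N - s)%N) big_addn.
    have -> : (N - (N - s) = s)%N by lia.
    by apply: eq_big_nat => k /andP[_ ks]; rewrite addnC xs // addnC.
  by rewrite /w; ring.
have bE : bound_value x = columns_dp (fun k => w (N - s + k)%N) g s M.-1.
  apply: (@eq_columns_dp _ M) => [i _|k i ks _|]; last by lia.
    exact: gE.
  by rewrite /w /tuple_times xs.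
have bN : (N - s + s.-1 = N.-1)%N by lia.
have lN : (N.-1 < N)%N by lia.
have lM : (M.-1 < M)%N by lia.
have lp : (p.-1 < N)%N by lia.
pose d : cell M N := (Ordinal lM, Ordinal lN).
have N0 : (0 < N)%N by lia.
pose o : cell M N := (Ordinal M0, Ordinal N0).
have upper P : prefix_suffix_path p s P -> path_sum t pi P <= bound_value x.
  move=> [i [a [b [c [e [q1 [q2 [q3 [[]]]]]]]]]].
  move=> [a1 a2] [b1 b2] [c1 c2] [e1 e2] [[pq1 l1] r2 [pq3 l3] ->].
  rewrite path_sumE -/w bE big_cons !big_cat /=.
  move: a1 a2 b1 b2 c1 c2 e1 e2 => /= [a1] [a2] b1 b2 c1 c2 e1 e2.
  have := rd_path_sum_le w (fun=> 0) pq1 (leq0n _).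
  lazy zeta; rewrite l1 !subn0 a1 a2 b2 => le1.
  have [_ _ ->] := right_path_sum w r2.
  have Nsc : (N - s <= c.2)%N by lia.
  have := rd_path_sum_le w g pq3 Nsc.
  lazy zeta; rewrite l3; have -> : (e.2 - (N - s)).+1 = s by lia.
  have -> : nat_of_ord e.1 = M.-1 by lia.
  apply: le_trans; rewrite !addrA lerD2r.
  have -> : (c.2 - (N - s) = 0)%N by lia.
  apply: le_trans (column_dp_right _ _ _); rewrite /= addn0 /g pre.
  have -> : nat_of_ord c.1 = b.1 by lia.
  have -> : (c.2.+1 = (N - s).+1)%N by lia.
  rewrite [\sum_(b.2.+1 <= k < _) _]big_nat_recr /=; last by lia.
  rewrite addrA lerD2r b2 lerD2r.
  by move: le1; rewrite /= add0r.
split; last by move=> v [P uP ->]; exact: upper.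
have [c [q3 [p3 c2 le3]]] :=
  @rd_path_attains _ M N w (N - s) g s.-1 d (esym bN).
pose b : cell M N := (c.1, Ordinal lp).
have [a [q1 [p1 a2 le1]]] :=
  @rd_path_attains _ M N w 0 (fun=> 0) p.-1 b (esym (add0n _)).
have [q0 p0'] : exists q, rd_path o q a.
  by apply: exists_down_path => //; apply: val_inj; rewrite /= a2.
have bc2 : (b.2 <= c.2)%N by rewrite c2 /=; lia.
have [q2 p2] := exists_right_path (erefl : b.1 = c.1) bc2.
have uP : prefix_suffix_path p s (o :: (q0 ++ q1) ++ q2 ++ q3).
  exists c.1.+1, o, b, c, d, (q0 ++ q1), q2, q3; split.
    by split; rewrite /pos //= ?c2; congr pair; lia.
  by split=> //; apply: rd_path_cat p1.
exists (o :: (q0 ++ q1) ++ q2 ++ q3) => //.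
apply/eqP; rewrite eq_le (upper _ uP) andbT bE path_sumE -/w.
rewrite prednK // in le3; apply: le_trans le3 _.
rewrite 2!big_cons !big_cat /=.
rewrite prednK //= add0r -pre in le1.
(* The prolongation [q0] ends in [a], so its sum is at least that of [a]. *)
have ws : w a.2 a.1 <= w o.2 o.1 + \sum_(e <- q0) w e.2 e.1.
  have <- : \sum_(e <- o :: q0) w e.2 e.1
      = w o.2 o.1 + \sum_(e <- q0) w e.2 e.1.
    by rewrite big_cons.
  by case: p0' => _ <-; rewrite lastI big_rcons /= lerDr sumr_ge0.
have [_ _ s2] := right_path_sum w p2.
rewrite s2 /g /=; rewrite big_nat_recr /=; last by rewrite c2; lia.
move: le1 ws; rewrite big_cons c2 (prednK p0) /=.
lra.
Qed.

End BoundValue.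

(** * Ordered choices, permutations and base-N numerals *)

Definition injective_below (L : nat) (x : nat -> nat) : Prop :=
  forall j k, j < L -> k < L -> x j = x k -> j = k.

(** List the first jobs, then all jobs that do not occur in [x], then the last
    jobs: this list is a rearrangement of all jobs. *)
Lemma perm_of_ends N p s (x : nat -> nat) :
  p + s <= N -> (forall k, k < p + s -> x k < N) -> injective_below (p + s) x ->
  exists pi : 'S_N,
    (forall k, k < p -> x k = perm_job pi k) /\
    (forall k, k < s -> x (p + k) = perm_job pi (N - s + k)).
Proof.
move=> psN xN xinj.
pose pre := [seq x k | k <- iota 0 p].
pose suf := [seq x k | k <- iota p s].
pose mid : seq nat := [seq j <- iota 0 N | j \notin pre ++ suf].
have eq_ends : pre ++ suf = [seq x k | k <- iota 0 (p + s)].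
  by rewrite iotaD map_cat.
have ends_in (j : nat) : j \in pre ++ suf -> j < N.
  by rewrite eq_ends => /mapP[k]; rewrite mem_iota => /xN + ->.
have uends : uniq (pre ++ suf).
  rewrite eq_ends map_inj_in_uniq ?iota_uniq // => j k.
  by rewrite !mem_iota; apply: xinj.
have perm_all : perm_eq (mid ++ (pre ++ suf)) (iota 0 N).
  apply: uniq_perm; rewrite ?iota_uniq //.
    rewrite cat_uniq uends filter_uniq ?iota_uniq //= andbT.
    apply/hasPn => j jin; by rewrite mem_filter jin.
  move=> j; rewrite mem_cat mem_filter mem_iota /= add0n.
  case: (boolP (j \in pre ++ suf)) => jin; last by rewrite orbF.
  by rewrite (ends_in _ jin).
have perm_l : perm_eq (pre ++ mid ++ suf) (iota 0 N).
  by rewrite -(permPr perm_all) perm_catCA.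
pose l := pre ++ mid ++ suf.
have size_l : size l = N by rewrite (perm_size perm_l) size_iota.
have size_pre : size pre = p by rewrite size_map size_iota.
have size_suf : size suf = s by rewrite size_map size_iota.
have size_mid : size mid = N - s - p.
  by move: size_l; rewrite !size_cat size_pre size_suf; lia.
have lN (i : 'I_N) : nth 0 l i < N.
  have : nth 0 l i \in l by rewrite mem_nth ?size_l.
  by rewrite (perm_mem perm_l) mem_iota.
have finj : injective (fun i : 'I_N => Ordinal (lN i)).
  move=> i j /(congr1 val)/= /eqP; rewrite nth_uniq ?size_l //.
    by move/eqP/val_inj.
  by rewrite (perm_uniq perm_l) iota_uniq.
have job k : k < N -> perm_job (perm finj) k = nth 0 l k.
  move=> kN; rewrite -[k]/(nat_of_ord (Ordinal kN)).
  by rewrite /perm_job valK permE.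
exists (perm finj); split=> k kl.
  rewrite job; last by lia.
  by rewrite nth_cat size_pre kl (nth_map 0) ?size_iota // nth_iota.
rewrite job; last by lia.
rewrite nth_cat size_pre ltnNge.
have -> /= : p <= N - s + k by lia.
rewrite nth_cat size_mid ltnNge.
have -> /= : N - s - p <= N - s + k - p by lia.
have -> : N - s + k - p - (N - s - p) = k by lia.
by rewrite (nth_map 0) ?size_iota // nth_iota.
Qed.

Definition perm_ends N (pi : 'S_N) p s (k : nat) : nat :=
  perm_job pi (if k < p then k else N - s + (k - p)).

Lemma perm_job_lt N (pi : 'S_N) k : k < N -> perm_job pi k < N.
Proof. by move=> kN; rewrite /perm_job insubT /=. Qed.

Lemma perm_job_inj N (pi : 'S_N) : injective_below N (perm_job pi).
Proof.
move=> j k jN kN; rewrite /perm_job !insubT /=.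
by move/val_inj/perm_inj/(congr1 val).
Qed.

Lemma perm_ends_lt N (pi : 'S_N) p s k :
  p + s <= N -> k < p + s -> perm_ends pi p s k < N.
Proof. by move=> psN kps; apply: perm_job_lt; case: ifP => hk; lia. Qed.

Lemma perm_ends_inj N (pi : 'S_N) p s :
  p + s <= N -> injective_below (p + s) (perm_ends pi p s).
Proof.
move=> psN j k jl kl e.
have col_lt i : i < p + s -> (if i < p then i else N - s + (i - p)) < N.
  by case: ifP => hk; lia.
have := perm_job_inj (col_lt _ jl) (col_lt _ kl) e.
by case: ifP => hj; case: ifP => hk; lia.
Qed.

Definition digits_value (b L : nat) (x : nat -> nat) : nat :=
  \sum_(0 <= k < L) x k * b ^ k.

Lemma digits_valueS b L x :
  digits_value b L.+1 x = digits_value b L x + x L * b ^ L.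
Proof. by rewrite /digits_value big_nat_recr. Qed.

Lemma eq_digits_value b L x y :
  (forall k, k < L -> x k = y k) -> digits_value b L x = digits_value b L y.
Proof. by move=> xy; apply: eq_big_nat => k /andP[_ kL]; rewrite xy. Qed.

Lemma digits_value_lt b L x :
  (forall k, k < L -> x k < b) -> digits_value b L x < b ^ L.
Proof.
elim: L => [|L IH] xb; first by rewrite /digits_value big_geq.
rewrite digits_valueS expnS.
have h1 := IH (fun k kL => xb k (ltnW kL)).
have h2 := xb L (ltnSn L).
apply: (@leq_trans ((x L).+1 * b ^ L)); last by rewrite leq_mul2r h2 orbT.
by rewrite mulSn ltn_add2r.
Qed.

Lemma digits_value_inj b L x y :
  (forall k, k < L -> x k < b) -> (forall k, k < L -> y k < b) ->
  digits_value b L x = digits_value b L y -> forall k, k < L -> x k = y k.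
Proof.
elim: L => [|L IH] xb yb //; rewrite !digits_valueS => e.
have xL := digits_value_lt (fun k kL => xb k (ltnW kL)).
have yL := digits_value_lt (fun k kL => yb k (ltnW kL)).
have bL0 : 0 < b ^ L by apply: leq_ltn_trans xL.
have quot n z : n < b ^ L -> (n + z * b ^ L) %/ b ^ L = z.
  by move=> nL; rewrite addnC divnMDl // divn_small // addn0.
have eL : x L = y L by rewrite -[LHS](quot _ _ xL) e quot.
move=> k; rewrite ltnS leq_eqVlt => /predU1P[->//|].
apply: IH => [j jL|j jL|]; [exact/xb/ltnW|exact/yb/ltnW|].
by move: e; rewrite eL => /addIn.
Qed.

(** * The program *)

Local Notation vN := 0 (only parsing).
Local Notation vM := 1 (only parsing).
Local Notation vP := 2 (only parsing).
Local Notation vS := 3 (only parsing).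
Local Notation vL := 4 (only parsing).
Local Notation vCarry := 5 (only parsing).
Local Notation vFound := 6 (only parsing).
Local Notation vK := 7 (only parsing).
Local Notation vI := 8 (only parsing).
Local Notation vOk := 9 (only parsing).
Local Notation vJ := 10 (only parsing).
Local Notation aX := 0 (only parsing).
Local Notation aLast := 1 (only parsing).
Local Notation rBest := 0 (only parsing).
Local Notation rRun := 1 (only parsing).
Local Notation aDp := 0 (only parsing).
Local Notation aSum := 1 (only parsing).
Local Notation "c1 ;; c2" := (Seq c1 c2) (at level 90, right associativity).

(** The arrays of row totals and of digits, the carry and the flag [vFound] are
    initially zero, which is the value each of them has to start from. *)
Definition sum_rows : com :=
  For vI vM
    (For vK vN
      (RArrSet aSum (IVar vI)
        (ROp Add (RArr aSum (IVar vI)) (RInput (IVar vI) (IVar vK))))).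

(** [rRun] carries the new value of the row above while the array is overwritten
    from the top. In row 0 there is no row above, and the old value of row 0
    itself makes the maximum trivial. *)
Definition column : com :=
  RSet rRun (RArr aDp (IConst 0)) ;;
  For vI vM
    (If (RLe (RArr aDp (IVar vI)) (RVar rRun)) Skip
        (RSet rRun (RArr aDp (IVar vI))) ;;
     RSet rRun (ROp Add (RVar rRun) (RInput (IVar vI) (IArr aX (IVar vK)))) ;;
     RArrSet aDp (IVar vI) (RVar rRun)).

Definition clear : com := For vI vM (RArrSet aDp (IVar vI) (RConst 0)).

Definition cross_middle : com :=
  For vI vM
    (RArrSet aDp (IVar vI)
       (ROp Add (RArr aDp (IVar vI)) (RArr aSum (IVar vI))) ;;
     For vJ vL
       (RArrSet aDp (IVar vI)
          (ROp Defs.Sub (RArr aDp (IVar vI))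
             (RInput (IVar vI) (IArr aX (IVar vJ)))))).

(** The second sweep continues from [vK] = p, where the first one stops. *)
Definition evaluate : com :=
  clear ;; ISet vK (IConst 0) ;; Upto vK vP column ;; cross_middle ;;
  Upto vK vL column.

(** After the first loop, [aLast] holds at address y the last position k with
    x k = y; the second loop looks for a position that is not the last one with
    its value. Only addresses written in the first loop are read, so remnants of
    earlier tuples in [aLast] do no harm. *)
Definition check_distinct : com :=
  For vK vL (IArrSet aLast (IArr aX (IVar vK)) (IVar vK)) ;;
  ISet vOk (IConst 1) ;;
  For vK vL
    (If (ILe (IArr aLast (IArr aX (IVar vK))) (IVar vK)) Skip
        (ISet vOk (IConst 0))).

Definition corner : rexp := RArr aDp (ISub (IVar vM) (IConst 1)).

Definition record : com := RSet rBest corner ;; ISet vFound (IConst 1).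

(** The first admissible tuple has no earlier value to be compared with;
    [vFound] singles it out, in place of an infinite initial minimum. *)
Definition compare : com :=
  If (ILe (IConst 1) (IVar vOk))
     (If (ILe (IVar vFound) (IConst 0)) record
         (If (RLe corner (RVar rBest)) record Skip))
     Skip.

(** The carry is propagated through all positions, also after it has become 0; a
    carry out of the last one means that all tuples have been visited. *)
Definition next_tuple : com :=
  ISet vCarry (IConst 1) ;;
  For vK vL
    (IArrSet aX (IVar vK) (IAdd (IArr aX (IVar vK)) (IVar vCarry)) ;;
     If (ILe (IVar vN) (IArr aX (IVar vK)))
        (IArrSet aX (IVar vK) (IConst 0) ;; ISet vCarry (IConst 1))
        (ISet vCarry (IConst 0))).

Definition bound_program : com :=
  ISet vL (IAdd (IVar vP) (IVar vS)) ;; sum_rows ;;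
  While (ILe (IVar vCarry) (IConst 0))
    (evaluate ;; check_distinct ;; compare ;; next_tuple).

(** * Correctness and running time *)

Section Specs.
Variables (R : realFieldType) (M N : nat) (t : 'M[R]_(M, N)) (p s : nat).
Implicit Types st : state R.
Local Notation wp := (wp t).

Lemma wp_sum_rows st :
  ivar st vM = M -> ivar st vN = N -> rarr st aSum = (fun _ => 0%R) ->
  wp sum_rows (M * (N * 20 + 20) + 10)
    (fun st' => forall i, i < M -> rarr st' aSum i = row_sum t i) st.
Proof.
move=> eM eN e0.
pose I m st' := (forall i, i < m -> rarr st' aSum i = row_sum t i) /\
  (forall i, m <= i -> rarr st' aSum i = 0%R).
apply: wp_weaken (_ : wp _ (M * ((N * (8 + 10) + 8) + 10) + 8) _ st) _;
  last by lia.
apply: wp_conseq (_ : wp _ _ (I M) st) _; last by move=> st' _ [].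
apply: (wp_for (I := I)) => //; first by split=> //= i _; rewrite e0.
move=> m st' mM em [ag _ _ _] [I1 I2].
pose J k st2 := (forall i, i != m -> rarr st2 aSum i = rarr st' aSum i) /\
  rarr st2 aSum m = (\sum_(0 <= j < k) entry t m j)%R.
apply: wp_conseq (_ : wp _ _ (J N) st') _; last first.
  move=> st2 _ [J1 J2]; split=> i /= im.
    case: (eqVneq i m) => [->//|ne]; rewrite J1 // I1 //.
    by rewrite ltn_neqAle ne.
  by rewrite J1 ?I2 //; [apply: ltnW|rewrite gtn_eqF].
apply: (wp_for (I := J)) => //=; first by rewrite ag.
  by split=> //=; rewrite I2 // big_geq.
move=> k st2 kN ek [ag2 _ _ _] [J1 J2].
have em2 : ivar st2 vI = m by rewrite ag2.
apply: wp_rarrset; rewrite /= em2 ek; split=> /= [i ne|].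
  by rewrite /upd /= (negbTE ne) J1.
by rewrite /upd /= eqxx J2 big_nat_recr.
Qed.

Lemma wp_column st :
  ivar st vM = M ->
  wp column (M * 30 + 20)
    (fun st' => forall i, i < M -> rarr st' aDp i =
       column_dp (rarr st aDp) (fun i => entry t i (iarr st aX (ivar st vK))) i)
    st.
Proof.
move=> eM; set x := iarr _ _ _; set g := rarr st aDp.
pose u i := entry t i x; rewrite -/u.
pose I m st' := [/\ forall i, i < m -> rarr st' aDp i = column_dp g u i,
  forall i, m <= i -> rarr st' aDp i = g i
  & rvar st' rRun = if m is m'.+1 then column_dp g u m' else g 0].
have stepE m run : run = (if m is m'.+1 then column_dp g u m' else g 0) ->
  column_dp g u m = (Num.max (g m) run + u m)%R.
  by case: m => [|m] ->; rewrite //= maxxx.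
apply: wp_weaken (_ : wp _ (3 + (M * (18 + 10) + 8)) _ st) _; last by lia.
apply: wp_seq; apply: wp_rset => /=.
apply: wp_conseq (_ : wp _ _ (I M) _) _; last by move=> st' _ [].
apply: (wp_for (I := I)) => //= m st' mM em [agi aga _ _] [I1 I2 I3].
apply: wp_weaken (_ : wp _ (8 + (7 + 3)) _ _) _ => //.
apply: wp_seq_agree (_ : wp _ _ (fun st2 => rvar st2 rRun =
  Num.max (rarr st' aDp m) (rvar st' rRun)) _) _.
  apply: wp_weaken; first apply: wp_if => /=.
  - by rewrite em => le; apply: wp_skip; apply/esym/max_idPr.
  - rewrite em -ltNge => le; apply: wp_rset => /=; rewrite em.
    by apply/esym/max_idPl/ltW.
  by [].
move=> st2 [agi2 aga2 _ agr2] e2.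
apply: wp_weaken (_ : wp _ ((1 + 6) + (1 + 1 + 1)) _ _) _ => //.
apply: wp_seq; apply: wp_rset; apply: wp_rarrset => /=.
have ei : ivar st2 vI = m by rewrite agi2.
have -> : entry t (ivar st2 vI) (iarr st2 aX (ivar st2 vK)) = u m.
  by rewrite ei aga2 // aga // agi2 // agi.
rewrite ei {1}/upd /= e2 I2 // -(stepE _ _ I3).
split=> [i im|i im|//]; rewrite /= /upd /= agr2 //.
  by case: eqP => [->//|/eqP ne]; apply: I1; rewrite ltn_neqAle ne.
by rewrite gtn_eqF // I2 // ltnW.
Qed.

Lemma wp_columns y a b st :
  y \notin [:: vK; vI] -> ivar st vM = M -> ivar st vK = a -> ivar st y = b ->
  a <= b ->
  wp (Upto vK y column) ((b - a) * (M * 30 + 30) + 6)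
    (fun st' => (forall i, i < M -> rarr st' aDp i =
       columns_dp (fun k => tuple_times t (iarr st aX) (a + k)) (rarr st aDp)
         (b - a) i) /\ ivar st' vK = b) st.
Proof.
move=> yv eM ea eb ab.
pose u k := tuple_times t (iarr st aX) (a + k).
pose I k st' := forall i, i < M -> rarr st' aDp i =
  columns_dp u (rarr st aDp) (k - a) i.
apply: wp_weaken (_ : wp _ ((b - a) * ((M * 30 + 20) + 10) + 6) _ st) _;
  last by rewrite -addnA.
apply: (@wp_conseq _ _ _ t _ _ (fun st' => I b st' /\ ivar st' vK = b)) => //.
apply: (wp_upto (I := I)) => //.
- by move: yv; rewrite /ivar_writes /= !inE !negb_or => /andP[-> ->].
- by rewrite /I subnn.
move=> k st' /andP[ak kb] ek [agi aga _ _] Ik.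
apply: wp_conseq; first by apply: wp_column; rewrite agi.
move=> st2 _ H i iM /=; rewrite H // subSn //=.
apply: (@eq_column_dp _ M) => // j jM.
by rewrite /u /tuple_times subnKC // aga // ek.
Qed.

Lemma wp_clear st :
  ivar st vM = M ->
  wp clear (M * 13 + 8) (fun st' => forall i, i < M -> rarr st' aDp i = 0%R) st.
Proof.
move=> eM.
apply: (@wp_for _ _ _ _ _ _ _
  (fun m st' => forall i, i < m -> rarr st' aDp i = 0%R) _ 3) => //=.
move=> m st' mM em _ IH.
apply: wp_rarrset => /= i im; rewrite em /upd /=.
by case: eqP => // /eqP ne; apply: IH; rewrite ltn_neqAle ne.
Qed.

Lemma wp_cross_middle st :
  ivar st vM = M -> ivar st vL = p + s ->
  wp cross_middle (M * ((p + s) * 20 + 30) + 8)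
    (fun st' => forall i, i < M -> rarr st' aDp i =
       (rarr st aDp i + rarr st aSum i - used_time t p s (iarr st aX) i)%R) st.
Proof.
move=> eM eL.
set x := iarr st aX; set g := rarr st aDp; set S := rarr st aSum.
pose I m st' :=
  (forall i, i < m -> rarr st' aDp i = (g i + S i - used_time t p s x i)%R) /\
  (forall i, m <= i -> rarr st' aDp i = g i).
apply: wp_weaken
  (_ : wp _ (M * (((1 + 1 + 5) + ((p + s) * ((1 + 1 + 7) + 10) + 8)) + 10)
             + 8) _ st) _; last by lia.
apply: wp_conseq (_ : wp _ _ (I M) st) _; last by move=> st' _ [].
apply: (wp_for (I := I)) => // m st' mM em [agi aga _ agr] [I1 I2].
apply: wp_seq; apply: wp_rarrset; rewrite /= em.
set st1 := set_rarr _ _ _ _.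
pose J k st2 := (forall i, i != m -> rarr st2 aDp i = rarr st' aDp i) /\
  rarr st2 aDp m = (g m + S m - \sum_(0 <= j < k) entry t m (x j))%R.
apply: wp_conseq (_ : wp _ _ (J (p + s)) st1) _; last first.
  move=> st2 _ [J1 J2]; split=> i /= im.
    case: (eqVneq i m) => [->//|ne]; rewrite J1 // I1 //.
    by rewrite ltn_neqAle ne.
  by rewrite J1 ?I2 //; [apply: ltnW|rewrite gtn_eqF].
have iI1 : ivar st1 vI = m by [].
apply: (wp_for (I := J)) => //=.
- by rewrite agi.
- split=> /= [i ne|]; rewrite /upd /= ?(negbTE ne) // eqxx.
  by rewrite I2 // agr // big_geq // subr0.
move=> k st2 kN ek [ag2 aa2 _ _] [J1 J2].
have em2 : ivar st2 vI = m by rewrite ag2.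
apply: wp_rarrset; rewrite /= em2 ek; split=> /= [i ne|].
  by rewrite /upd /= (negbTE ne) J1.
rewrite /upd /= eqxx J2 big_nat_recr //= aa2 //= aga //.
by rewrite opprD addrA.
Qed.

Definition ready st : Prop :=
  [/\ ivar st vN = N, ivar st vM = M, ivar st vP = p, ivar st vL = p + s
  & forall i, i < M -> rarr st aSum i = row_sum t i].

Lemma ready_agree c st st' :
  all (fun x => x \notin ivar_writes c) [:: vN; vM; vP; vL] ->
  aSum \notin rarr_writes c -> agree c st st' -> ready st -> ready st'.
Proof.
move=> /and5P[w1 w2 w3 w4 _] w5 [ai _ _ ar] [r1 r2 r3 r4 r5].
by split; rewrite ?ai //; rewrite ar.
Qed.

Lemma wp_evaluate st :
  0 < M -> 0 < p -> 0 < s -> ready st ->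
  wp evaluate (200 * (M * (p + s)))
    (fun st' => rarr st' aDp M.-1 = bound_value t p s (iarr st aX)) st.
Proof.
move=> M0 p0 s0 [eN eM eP eL eS].
set x := iarr st aX.
apply: wp_weaken (_ : wp _ ((M * 13 + 8) + (2 + (((p - 0) * (M * 30 + 30) + 6) +
  ((M * ((p + s) * 20 + 30) + 8)
   + ((p + s - p) * (M * 30 + 30) + 6))))) _ st) _;
  last by rewrite subn0 addKn; nia.
apply: wp_seq_agree (wp_clear eM) _ => st1 [i1 x1 _ r1] D1.
apply: wp_seq; apply: wp_iset => /=.
apply: wp_seq_agree.
  by apply: wp_columns => //=; rewrite ?/upd /= ?i1.
move=> st2 [/= i2 x2 _ r2] [D2 k2].
apply: wp_seq_agree.
  by apply: wp_cross_middle; rewrite i2 // /upd /= i1.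
move=> st3 [/= i3 x3 _ r3] D3.
have x3E : iarr st3 aX = x by rewrite x3 // x2 // x1.
apply: wp_conseq.
  apply: (@wp_columns _ p (p + s)) => //.
  - by rewrite i3 // i2 // /upd /= i1.
  - by rewrite i3 // k2 eP.
  - by rewrite i3 // i2 // /upd /= i1.
  exact: leq_addr.
move=> st4 _ [D4 _]; rewrite D4; last by lia.
rewrite addKn x3E; apply: (@eq_columns_dp _ M) => // [i iM|]; last by lia.
rewrite D3 // D2 // subn0 x2 //= x1 // -/x.
rewrite r2 //= (r1 aSum) // eS //; congr (_ + _ - _)%R.
exact: (@eq_columns_dp _ M).
Qed.

Lemma wp_check_distinct st :
  ivar st vL = p + s ->
  wp check_distinct ((p + s) * 40 + 20)
    (fun st' => 0 < ivar st' vOk <-> injective_below (p + s) (iarr st aX)) st.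
Proof.
move=> eL; set x := iarr st aX; set L := p + s.
pose I m st' := forall j, j < m ->
  j <= iarr st' aLast (x j) < m /\ x (iarr st' aLast (x j)) = x j.
apply: wp_weaken (_ : wp _ ((L * ((1 + 2 + 1) + 10) + 8) +
  (2 + (L * ((1 + 5 + maxn 1 2) + 10) + 8))) _ st) _;
  last by rewrite /maxn /=; lia.
apply: (wp_seq_agree (P := I L)).
  apply: (wp_for (I := I)) => // m st' mL em [_ xx _ _] Im.
  apply: wp_iarrset => /= j jm; rewrite /= em (xx aX) // -/x /upd /=.
  case: (eqVneq (x j) (x m)) => [e|ne]; first by rewrite ltnSn andbT.
  have jm' : j < m.
    by rewrite ltn_neqAle -ltnS jm andbT; apply: contra_neq ne => ->.
  have [/andP[h1 h2] h3] := Im j jm'.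
  by rewrite h1 h3 ltnS ltnW.
move=> st1 [i1 x1 _ _] I1.
have x1E : iarr st1 aX = x by rewrite x1.
set y := iarr st1 aLast in I1.
pose J m st' := (0 < ivar st' vOk) <-> (forall j, j < m -> y (x j) <= j).
apply: wp_seq; apply: wp_iset => /=.
set st2 := set_ivar _ _ _.
apply: wp_conseq (_ : wp _ _ (J L) st2) _.
  apply: (wp_for (I := J)) => //=.
    by rewrite /upd /= i1.
  move=> m st' mL em [_ xx _ _] Jm.
  apply: wp_if; rewrite /= em !xx //= x1E -/y => le.
    apply: wp_skip; split.
      move=> ok j; rewrite ltnS leq_eqVlt => /predU1P[->//|]; exact: (Jm.1 ok).
    by move=> h; apply/Jm => j jm; apply: h; apply: ltnW.
  apply: wp_iset; split=> //= h; by rewrite h in le.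
move=> st' _ Jl; split=> [/Jl h j k jL kL e|inj].
  have [/andP[h1 _] _] := I1 _ jL; have [/andP[h2 _] _] := I1 _ kL.
  by apply/eqP; rewrite eqn_leq (leq_trans h1) ?e ?h // (leq_trans h2) // -e h.
apply/Jl => j jL; have [/andP[h1 h2] h3] := I1 _ jL.
by rewrite /y (inj _ _ h2 jL h3).
Qed.

(** At the last tuple all digits return to 0, and the carry out of the numeral
    stands for the missing N ^ (p + s). *)
Lemma wp_next_tuple st :
  ivar st vL = p + s -> ivar st vN = N ->
  (forall k, k < p + s -> iarr st aX k < N) ->
  wp next_tuple ((p + s) * 40 + 20)
    (fun st' => [/\ digits_value N (p + s) (iarr st' aX)
                      + ivar st' vCarry * N ^ (p + s)
                    = (digits_value N (p + s) (iarr st aX)).+1,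
      ivar st' vCarry <= 1
    & forall k, k < p + s -> iarr st' aX k < N]) st.
Proof.
move=> eL eN; set L := p + s; set x := iarr st aX => xN.
pose I m st' := [/\ digits_value N m (iarr st' aX) + ivar st' vCarry * N ^ m
                    = (digits_value N m x).+1,
   ivar st' vCarry <= 1, forall k, k < m -> iarr st' aX k < N
 & forall k, m <= k -> iarr st' aX k = x k].
apply: wp_weaken (_ : wp _ (2 + (L * (((1 + 1 + 4)
  + (1 + 4 + maxn ((1 + 1 + 1) + (1 + 1)) (1 + 1))) + 10) + 8)) _ st) _;
  last by rewrite /maxn /=; lia.
apply: wp_seq; apply: wp_iset => /=.
apply: wp_conseq (_ : wp _ _ (I L) _) _; last by move=> st' _ [].
apply: (wp_for (I := I)) => //.
  by split=> //=; rewrite /digits_value !big_geq.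
move=> m st' mL em [i1 _ _ _] [I1 I2 I3 I4].
apply: wp_seq; apply: wp_iarrset; rewrite /= em I4 //.
have xm := xN _ mL.
apply: wp_if; rewrite /= em (i1 vN) //= /upd /= eqxx eN => le.
  apply: wp_seq; apply: wp_iarrset; apply: wp_iset => /=; rewrite em.
  have xmE : x m + ivar st' vCarry = N by lia.
  split=> //=; rewrite {1}/upd /=.
  - rewrite !digits_valueS /upd /= eqxx mul0n addn0 mul1n expnS.
    rewrite (@eq_digits_value _ _ _ (iarr st' aX)); last first.
      by move=> k km; rewrite !ltn_eqF.
    by rewrite -[X in X * _]xmE mulnDl addnCA addnA -addSn -I1; lia.
  - move=> k; rewrite ltnS leq_eqVlt /upd /= => /predU1P[->|km].
      by rewrite eqxx; apply: leq_ltn_trans xm.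
    by rewrite !ltn_eqF // I3.
  - by move=> k km; rewrite /upd /= !gtn_eqF // I4 // ltnW.
apply: wp_iset; split=> //=.
- rewrite !digits_valueS /upd /= eqxx mul0n addn0.
  rewrite (@eq_digits_value _ _ _ (iarr st' aX)); last first.
    by move=> k km; rewrite ltn_eqF.
  by rewrite -addSn -I1 mulnDl; lia.
- move=> k; rewrite ltnS leq_eqVlt /upd /= => /predU1P[->|km].
    by rewrite eqxx ltnNge.
  by rewrite ltn_eqF // I3.
- by move=> k km; rewrite /upd /= gtn_eqF // I4 // ltnW.
Qed.

Lemma eq_bound_value (x y : nat -> nat) :
  0 < M -> (forall k, k < p + s -> x k = y k) ->
  bound_value t p s x = bound_value t p s y.
Proof.
move=> M0 xy; apply: (@eq_columns_dp _ M) => [i iM|k i ks _|]; last by lia.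
  congr (_ + _ - _)%R.
    apply: (@eq_columns_dp _ M) => // k j kp _.
    by rewrite /tuple_times xy // ltn_addr.
  by apply: eq_big_nat => k /andP[_ kL]; rewrite xy.
by rewrite /tuple_times xy // ltn_add2l.
Qed.

Definition admissible (x : nat -> nat) : Prop :=
  (forall k, k < p + s -> x k < N) /\ injective_below (p + s) x.

Definition best_before (r : nat) st : Prop :=
  (forall x, admissible x -> digits_value N (p + s) x < r ->
     0 < ivar st vFound /\ (rvar st rBest <= bound_value t p s x)%R) /\
  (0 < ivar st vFound ->
     exists2 x, admissible x & rvar st rBest = bound_value t p s x).

(** Base-N numerals are unique, so the current tuple is, up to values at
    positions beyond p + s, the only one with number [r]. *)
Lemma wp_compare r st :
  0 < M -> ready st -> (forall k, k < p + s -> iarr st aX k < N) ->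
  digits_value N (p + s) (iarr st aX) = r ->
  rarr st aDp M.-1 = bound_value t p s (iarr st aX) ->
  (0 < ivar st vOk <-> injective_below (p + s) (iarr st aX)) ->
  best_before r st ->
  wp compare 30 (best_before r.+1) st.
Proof.
move=> M0 [_ eM _ _ _]; set x := iarr st aX => xN xr cornerE okE [best1 best2].
have same y : admissible y -> digits_value N (p + s) y = r ->
    bound_value t p s y = bound_value t p s x /\ injective_below (p + s) x.
  move=> [yN yinj] yr.
  have yx := digits_value_inj yN xN (etrans yr (esym xr)).
  split; first exact: eq_bound_value.
  by move=> j k jL kL e; apply: yinj => //; rewrite !yx.
have recordP : injective_below (p + s) x ->
    (forall y, admissible y -> digits_value N (p + s) y < r ->
       (bound_value t p s x <= bound_value t p s y)%R) ->
    wp record 8 (best_before r.+1) st.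
  move=> xinj le; apply: wp_weaken (_ : wp _ (5 + 2) _ _) _ => //.
  apply: wp_seq; apply: wp_rset; apply: wp_iset.
  rewrite /= eM subn1 cornerE; split=> /= [y ya|_]; last by exists x.
  rewrite ltnS leq_eqVlt /upd /= => /predU1P[yr|yr]; split=> //.
    by rewrite (same y ya yr).1.
  exact: le.
have keepP : (injective_below (p + s) x ->
      0 < ivar st vFound /\ (rvar st rBest <= bound_value t p s x)%R) ->
    wp Skip 1 (best_before r.+1) st.
  move=> keep; apply: wp_skip; split=> // y ya.
  rewrite ltnS leq_eqVlt => /predU1P[yr|]; last exact: best1.
  by have [-> xinj] := same y ya yr; apply: keep.
apply: wp_weaken.
  apply: wp_if => /= [ok|nok].
    have xinj := okE.1 ok.
    apply: wp_if => /= [nf|f].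
      apply: recordP => // y ya yr; have [fnd _] := best1 y ya yr.
      by move: nf; rewrite leqNgt fnd.
    have fnd : 0 < ivar st vFound by rewrite ltnNge.
    apply: wp_if; rewrite /= eM subn1 cornerE => le.
      apply: recordP => // y ya yr; have [_] := best1 y ya yr; exact: le_trans.
    by apply: keepP => _; split=> //; apply: ltW; rewrite ltNge.
  by apply: keepP => /okE.2 ok; rewrite ok in nok.
by [].
Qed.

(** The tuples are counted by their numerals: the loop invariant equates the
    number of tuples treated with the value of the digits plus the final carry,
    so the loop runs N ^ (p + s) times and then has seen every tuple. *)
Lemma wp_bound_program :
  0 < M -> 0 < p -> 0 < s -> p + s <= N ->
  wp bound_program (500 * (N ^ (p + s) * M * (p + s)))
    (best_before (N ^ (p + s))) (init_state R M N p s).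
Proof.
move=> M0 p0 s0 psN; set L := p + s; set n := N ^ L.
pose cost := 200 * (M * L) + ((L * 40 + 20) + (30 + (L * 40 + 20))).
apply: wp_weaken (_ : wp _ ((1 + 3) + ((M * (N * 20 + 20) + 10) +
   ((n - 0) * (1 + 3 + cost) + (1 + 3)))) _ _) _; last first.
  (* An iteration costs at most 320 M (p + s), and all that is outside the loop
     at most 60 N ^ (p + s) M (p + s). *)
  have Nn : N <= n by rewrite -{1}(expn1 N) leq_pexp2l //; lia.
  have N1 : 1 < N by lia.
  have L1 : 1 < L by lia.
  have a1 : L <= M * L by apply: leq_pmull.
  have a2 : 2 <= M * L by apply: leq_trans a1.
  have a3 : cost + 4 <= 320 * (M * L) by rewrite /cost; lia.
  have a4 : n * (cost + 4) <= n * (320 * (M * L)) by rewrite leq_mul2l a3 orbT.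
  have a5 : M * N <= n * (M * L).
    by rewrite mulnC; apply: leq_mul => //; apply: leq_pmulr; lia.
  have a6 : M <= M * N by apply: leq_pmulr; lia.
  have a7 : 2 <= M * N by apply: leq_trans N1 _; apply: leq_pmull.
  have a8 : n * M * L = n * (M * L) by rewrite mulnA.
  rewrite a8 subn0.
  have a9 : n * (1 + 3 + cost) = n * (cost + 4) by rewrite addnC.
  rewrite a9.
  move: a4 a5 a6 a7; rewrite mulnCA mulnDr; lia.
apply: wp_seq; apply: wp_iset => /=.
apply: wp_seq_agree; first by apply: wp_sum_rows.
move=> st [ai ax av ar] sums.
pose I r st := [/\ ready st, forall k, k < L -> iarr st aX k < N,
  digits_value N L (iarr st aX) + ivar st vCarry * n = r, ivar st vCarry <= 1
  & best_before r st].
apply: wp_conseq (_ : wp _ _ (I n) st) _; last by move=> st' _ [].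
apply: (wp_while (I := I)) => //.
- split.
  + by split; rewrite ?ai.
  + by move=> k _; rewrite ax //=; lia.
  + rewrite ai // mul0n addn0 /digits_value big1_seq // => k _.
    by rewrite ax.
  + by rewrite ai.
  + by split=> // ; rewrite ai.
- move=> r st' [_ xN <- c1 _] /=.
  have := digits_value_lt xN; rewrite -/n => lt.
  move: c1; case: (ivar _ _) => [|[|//]] _; rewrite ?mul0n ?addn0 ?lt //.
  by rewrite mul1n; lia.
move=> r st0 /andP[_ rn] _ [rd0 xN dE c1 best].
have c0 : ivar st0 vCarry = 0.
  by case: (ivar _ _) c1 dE => [|[|//]] // _; rewrite mul1n; lia.
have {}dE : digits_value N L (iarr st0 aX) = r.
  by move: dE; rewrite c0 mul0n addn0.
apply: wp_seq_agree (wp_evaluate M0 p0 s0 rd0) _ => st1 ag1 corner1.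
have rd1 := ready_agree (c := evaluate) isT isT ag1 rd0.
have [i1 x1 v1 _] := ag1.
apply: (wp_seq_agree (wp_check_distinct _)).
  by case: rd1.
move=> st2 ag2 ok2.
have rd2 := ready_agree (c := check_distinct) isT isT ag2 rd1.
have [i2 x2 v2 r2] := ag2.
have x20 : iarr st2 aX = iarr st0 aX by rewrite x2 // x1.
apply: wp_seq_agree.
  apply: (wp_compare (r := r)) => //.
  - by rewrite x20.
  - by rewrite x20.
  - by rewrite r2 // corner1 x20.
  - by rewrite x20 -(x1 aX).
  by move: best; rewrite /best_before i2 // i1 // v2 // v1.
move=> st3 ag3 best3.
have rd3 := ready_agree (c := compare) isT isT ag3 rd2.
have [i3 x3 v3 r3] := ag3.
have x30 : iarr st3 aX = iarr st0 aX by rewrite x3 // x20.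
apply: wp_conseq.
  apply: wp_next_tuple; [by case: rd3|by case: rd3|by rewrite x30].
move=> st4 ag4 [d4 c4 x4].
split=> //.
- exact: ready_agree ag4 rd3.
- by rewrite d4 x30 dE.
have [i4 _ v4 _] := ag4.
by move: best3; rewrite /best_before i4 // v4.
Qed.

End Specs.

Theorem proposition8 (R : realFieldType) :
  exists (alg : com) (C : nat),
    forall (M N p s : nat) (t : 'M[R]_(M, N)),
      1 <= M -> 1 <= p -> 1 <= s -> p + s <= N ->
      (forall i j, (0 <= t i j)%R) ->
      exists (v : R) (T : nat),
        [/\ computes_in t alg p s v T,
            is_LB t p s v
          & T <= C * (N ^ (p + s) * M * (p + s))].
Proof.
exists bound_program, 500 => M N p s t M1 p1 s1 psN t0.
have [st [T [ex Tle [lower attained]]]] := wp_bound_program t M1 p1 s1 psN.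
have ends_adm (pi : 'S_N) : admissible N p s (perm_ends pi p s).
  by split=> [k|]; [apply: perm_ends_lt|apply: perm_ends_inj].
have ends_lt (pi : 'S_N) := digits_value_lt (ends_adm pi).1.
exists (rvar st 0), T; split=> //; first by exists st.
have [found _] := lower _ (ends_adm 1%g) (ends_lt 1%g).
split.
  have [x [xN xinj] ->] := attained found.
  have [pi [xp xs]] := perm_of_ends psN xN xinj.
  by exists pi; apply: bound_value_is_max.
move=> w [pi [[P uP wE] wmax]].
have [[P' uP' bE] bmax] : is_max (fun v =>
    exists2 P, prefix_suffix_path p s P & v = path_sum t pi P)
    (bound_value t p s (perm_ends pi p s)).
  apply: bound_value_is_max => // k kl; rewrite /perm_ends.
    by rewrite kl.
  by rewrite ltnNge leq_addr /= addKn.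
have [_ le] := lower _ (ends_adm pi) (ends_lt pi).
by apply: le_trans le _; apply: wmax; exists P'.
Qed.
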